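(* Assume conditions C1, C2a, C2b and C3, fix $\lambda>0$, and let $\widehat Y=\widehat Y_n\in L^\infty([0,T],\mathbb{R}^{d'})$ be an estimator of $Y^*$ that is consistent in probability in $L^2$, i.e. $\|\widehat Y_n-Y^*\|_{L^2}\to0$ in probability. Then the estimator $\widehat\theta^K=\arg\min_{\theta\in\Theta}S(\widehat Y;\theta,\lambda)$ satisfies $\widehat\theta^K\to\theta^*$ in probability.
   Context: Setting: $T>0$, $C\in\mathbb{R}^{d'\times d}$, $\Theta\subset\mathbb{R}^p$; for $\theta\in\Theta$, $A_\theta(t)\in\mathbb{R}^{d\times d}$, $r_\theta(t)\in\mathbb{R}^d$. $X_{\theta,x_0,u}$ solves $\dot x=A_\theta x+r_\theta+u$, $x(0)=x_0$; $X_{\theta,x_0}=X_{\theta,x_0,0}$. True parameter $\theta^*$, true initial condition $x_0^*$, $X^*=X_{\theta^*,x_0^*}$, $Y^*=CX^*$. Data $Y_i=CX^*(t_i)+\epsilon_i$, $i=1,\dots,n$, with random noise; $\widehat Y$ is a nonparametric estimator of $Y^*$ built from them. $S(Y;\theta,\lambda)=\inf_{x_0\in\mathbb{R}^d}\inf_{u\in L^2}\int_0^T(\|Y-CX_{\theta,x_0,u}\|_2^2+\lambda\|u\|_2^2)dt$ (i.e. with $Q=0$). $\Phi_\theta$ is the resolvent of $\dot x=A_\theta x$, $O_\theta(T)=\int_0^T\Phi_\theta(t,0)^TC^TC\Phi_\theta(t,0)dt$. Conditions: C1: $\Theta$ compact, $\theta^*$ in its interior. C2a: $O_\theta(T)$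 nonsingular for all $\theta\in\Theta$. C2b: for all $(\theta,x_0)\in\Theta\times\mathbb{R}^d$, $CX_{\theta,x_0}=CX_{\theta^*,x_0^*}$ implies $(\theta,x_0)=(\theta^*,x_0^* )$. C3: $(t,\theta)\mapsto A_\theta(t)$, $(t,\theta)\mapsto r_\theta(t)$ continuous on $[0,T]\times\Theta$. *)

(* Defs.v *)
From HB Require Import structures.
From mathcomp Require Import all_boot all_order all_algebra.
From mathcomp Require Import all_classical all_reals all_analysis measurable_realfun.
Set Implicit Arguments. Unset Strict Implicit. Unset Printing Implicit Defensive.
Import Order.TTheory GRing.Theory Num.Theory.
Import numFieldNormedType.Exports.
Local Open Scope classical_set_scope.
Local Open Scope ring_scope.

Section Defs.
Variable R : realType.
Local Notation mu := (@lebesgue_measure R).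

Definition sqnorm (k : nat) (v : 'cV[R]_k) : R := \sum_(i < k) v i 0 ^+ 2.

Definition is_L2 (T : R) (k : nat) (u : R -> 'cV[R]_k) : Prop :=
  (forall i, measurable_fun `[0%R, T] (fun t => u t i 0)) /\
  (\int[mu]_(t in `[0%R, T]) ((sqnorm (u t))%:E) < +oo)%E.

(* f : [0,T] -> R^k is (a bounded representative of an element) in L^oo *)
Definition is_Linfty (T : R) (k : nat) (y : R -> 'cV[R]_k) : Prop :=
  (forall i, measurable_fun `[0%R, T] (fun t => y t i 0)) /\
  exists M : R, forall t, t \in `[0%R, T] -> forall i, `|y t i 0| <= M.

Definition L2dist (T : R) (k : nat) (f g : R -> 'cV[R]_k) : \bar R :=
  poweR (\int[mu]_(t in `[0%R, T]) ((sqnorm (f t - g t))%:E)) 2^-1.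

(* X is the (Caratheodory) solution on [0,T] of
   x' = A x + r + u, x(0) = x0, written in integral form. *)
Definition solves_ode (T : R) (d : nat) (A : R -> 'M[R]_d) (r : R -> 'cV[R]_d)
    (u : R -> 'cV[R]_d) (x0 : 'cV[R]_d) (X : R -> 'cV[R]_d) : Prop :=
  forall i : 'I_d,
    mu.-integrable `[0%R, T] (fun s => ((A s *m X s + r s + u s) i 0)%:E) /\
    forall t, t \in `[0%R, T] ->
      X t i 0 = x0 i 0 + Rintegral mu `[0%R, t] (fun s => (A s *m X s + r s + u s) i 0).

(* Phi is the resolvent t |-> Phi(t,0) of x' = A x on [0,T]:
   Phi(t,0) = I + int_0^t A(s) Phi(s,0) ds. *)
Definition is_resolvent (T : R) (d : nat) (A : R -> 'M[R]_d) (Phi : R -> 'M[R]_d) : Prop :=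
  forall i j : 'I_d,
    mu.-integrable `[0%R, T] (fun s => ((A s *m Phi s) i j)%:E) /\
    forall t, t \in `[0%R, T] ->
      Phi t i j = (1%:M : 'M[R]_d) i j + Rintegral mu `[0%R, t] (fun s => (A s *m Phi s) i j).

Definition gramian (T : R) (d d' : nat) (C : 'M[R]_(d', d)) (Phi : R -> 'M[R]_d) : 'M[R]_d :=
  \matrix_(i, j) Rintegral mu `[0%R, T] (fun t => ((Phi t)^T *m C^T *m C *m Phi t) i j).

(* S(Y; theta, lambda) with Q = 0, for the model (A, r) = (A_theta, r_theta):
   inf over x0 in R^d and u in L^2 of int_0^T (||Y - C X||^2 + lambda ||u||^2) dt,
   where X = X_{theta,x0,u}. *)
Definition Scost (T : R) (d d' : nat) (C : 'M[R]_(d', d)) (A : R -> 'M[R]_d)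
    (r : R -> 'cV[R]_d) (lambda : R) (Y : R -> 'cV[R]_d') : \bar R :=
  ereal_inf [set J | exists (x0 : 'cV[R]_d) (u : R -> 'cV[R]_d) (X : R -> 'cV[R]_d),
     is_L2 T u /\ solves_ode T A r u x0 X /\
     J = (\int[mu]_(t in `[0%R, T])
            ((sqnorm (Y t - C *m X t) + lambda * sqnorm (u t))%:E))%E].

End Defs.

(* Main.v *)
Require Import Defs.
From HB Require Import structures.
From mathcomp Require Import all_boot all_order all_algebra.
From mathcomp Require Import all_classical all_reals all_analysis measurable_realfun.
From mathcomp Require Import ring lra.
Import Order.TTheory GRing.Theory Num.Theory.
Import numFieldNormedType.Exports.
Local Open Scope classical_set_scope.
Local Open Scope ring_scope.

(** Write [theta0], [Y0] for the true parameter and output.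
    The theorem reduces to a deterministic claim: if [Y] is L2-close to [Y0] and the
    cost of [theta] at [Y] is at most that of [theta0], then [theta] is close to
    [theta0].  The cost of [theta0] is at most [||Y - Y0||^2] (take zero control and
    the true initial condition), so such a [theta] admits a trajectory [X] with
    control [u] for which both [u] and [C X - Y0] are small, uniformly in [theta]
    (in L1, by AM-GM).

    By compactness of [Theta] this need only be excluded near each [theta <> theta0].
    There, let [Z] be the uncontrolled trajectory of [theta] with the initial
    condition [z] of [X].  Gronwall bounds [X - Z] by a small multiple of [1 + |z|].
    On the other hand [C Z - Y0 = (C xi - Y0) + C Phi z] is the value at [(1, z)] of a
    linear map on [R^(1+d)] which C2a and C2b make injective, so its L1 norm is at
    least a constant times [1 + |z|].  No a priori bound on [z] is needed. *)

(** * The entrywise l1 norm of matrices *)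

Section EntrywiseNorm.
Context {R : realType}.

(** Chosen because it is submultiplicative for matrices of all shapes and passes under the integral
    sign up to an inequality; AM-GM also applies to it entry by entry. *)
Definition n1 {m n} (M : 'M[R]_(m, n)) : R := \sum_i \sum_j `|M i j|.

Lemma n1_ge0 {m n} (M : 'M[R]_(m, n)) : 0 <= n1 M.
Proof. by apply: sumr_ge0 => i _; apply: sumr_ge0. Qed.

Lemma n1_entry {m n} (M : 'M[R]_(m, n)) i j : `|M i j| <= n1 M.
Proof.
rewrite /n1 (bigD1 i)//= (bigD1 j)//= -addrA lerDl addr_ge0//.
  exact: sumr_ge0.
by apply: sumr_ge0 => k _; apply: sumr_ge0.
Qed.

Lemma n1_cV {n} (v : 'cV[R]_n) : n1 v = \sum_i `|v i 0|.
Proof. by apply: eq_bigr => i _; rewrite big_ord1. Qed.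

Lemma n1D {m n} (M N : 'M[R]_(m, n)) : n1 (M + N) <= n1 M + n1 N.
Proof.
rewrite /n1 -big_split/= ler_sum// => i _; rewrite -big_split/= ler_sum// => j _.
by rewrite mxE ler_normD.
Qed.

Lemma n1N {m n} (M : 'M[R]_(m, n)) : n1 (- M) = n1 M.
Proof. by apply: eq_bigr => i _; apply: eq_bigr => j _; rewrite mxE normrN. Qed.

Lemma n1_mul {m n k} (M : 'M[R]_(m, n)) (N : 'M[R]_(n, k)) :
  n1 (M *m N) <= n1 M * n1 N.
Proof.
rewrite /n1 mulr_suml ler_sum// => i _.
have h j : `|(M *m N) i j| <= \sum_l `|M i l| * `|N l j|.
  rewrite mxE (le_trans (ler_norm_sum _ _ _))// ler_sum// => l _.
  by rewrite normrM.
apply: (le_trans (ler_sum _ (fun j _ => h j))).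
rewrite exchange_big/= mulr_suml ler_sum// => l _.
rewrite -mulr_sumr ler_wpM2l// [leRHS](bigD1 l)//= lerDl.
by apply: sumr_ge0 => a _; apply: sumr_ge0.
Qed.

Lemma n1_0 {m n} : n1 (0 : 'M[R]_(m, n)) = 0.
Proof. by apply: big1 => i _; apply: big1 => j _; rewrite mxE normr0. Qed.

Lemma n1_col_mx {m n k} (M : 'M[R]_(m, k)) (N : 'M[R]_(n, k)) :
  n1 (col_mx M N) = n1 M + n1 N.
Proof.
rewrite /n1 big_split_ord/=; congr (_ + _); do 2 (apply: eq_bigr => ? _).
  by rewrite col_mxEu.
by rewrite col_mxEd.
Qed.

End EntrywiseNorm.

(** * Integrals over [0, t] and Gronwall's inequality *)

Section Interval.
Context {R : realType} {T : R} (T_gt0 : 0 < T).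
Local Notation mu := (@lebesgue_measure R).
Implicit Types (f g : R -> R) (s t K a B : R).

Definition cont (f : R -> R) := {within `[0, T], continuous f}.
Definition intg (f : R -> R) := mu.-integrable `[0, T] (EFin \o f).

Lemma eq_cont f g : (forall t, t \in `[0, T] -> f t = g t) -> cont f -> cont g.
Proof. by move=> fg; apply: subspace_eq_continuous => t /[!inE] /fg. Qed.

Lemma cont_cst c : cont (fun=> c).
Proof. by apply: continuous_subspaceT => x; exact: cvg_cst. Qed.

Lemma contD f g : cont f -> cont g -> cont (fun t => f t + g t).
Proof. by move=> cf cg x; apply: cvgD; [exact: cf|exact: cg]. Qed.

Lemma contN f : cont f -> cont (fun t => - f t).
Proof. by move=> cf x; apply: cvgN; exact: cf. Qed.

Lemma contB f g : cont f -> cont g -> cont (fun t => f t - g t).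
Proof. by move=> cf cg; apply: contD => //; exact: contN. Qed.

Lemma contM f g : cont f -> cont g -> cont (fun t => f t * g t).
Proof. by move=> cf cg x; apply: cvgM; [exact: cf|exact: cg]. Qed.

Lemma cont_norm f : cont f -> cont (fun t => `|f t|).
Proof. by move=> cf x; apply: cvg_norm; exact: cf. Qed.

Lemma cont_sum I (s : seq I) (f : I -> R -> R) :
  (forall i, cont (f i)) -> cont (fun t => \sum_(i <- s) f i t).
Proof.
move=> cf; elim: s => [|i s ih].
  by under eq_fun do rewrite big_nil; exact: cont_cst.
by under eq_fun do rewrite big_cons; exact: contD.
Qed.

Lemma cont_intg f : cont f -> intg f.
Proof. by apply: continuous_compact_integrable; exact: segment_compact. Qed.

Lemma cont_bounded f : cont f ->
  exists2 M, 0 <= M & forall t, t \in `[0, T] -> f t <= M.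
Proof.
move=> /(EVT_max (ltW T_gt0))[c _ h].
exists (Num.max 0 (f c)); first by rewrite le_max lexx.
by move=> t /h ft; rewrite le_max ft orbT.
Qed.

Lemma eq_intg f g : (forall t, t \in `[0, T] -> f t = g t) -> intg f -> intg g.
Proof.
by move=> fg; apply: eq_integrable => // t /[!inE] /fg /= ->.
Qed.

Lemma intgD f g : intg f -> intg g -> intg (fun t => f t + g t).
Proof. by move=> F G; apply: (integrableD _ F G). Qed.

Lemma intgZ c f : intg f -> intg (fun t => c * f t).
Proof. by move=> F; apply: (integrableZl _ c F). Qed.

Lemma intgB f g : intg f -> intg g -> intg (fun t => f t - g t).
Proof. by move=> F G; apply: (integrableB _ F G). Qed.

Lemma intg_norm f : intg f -> intg (fun t => `|f t|).
Proof. exact: integrable_norm. Qed.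

Lemma intg_sum I (s : seq I) (f : I -> R -> R) :
  (forall i, intg (f i)) -> intg (fun t => \sum_(i <- s) f i t).
Proof.
move=> cf; elim: s => [|i s ih].
  by under eq_fun do rewrite big_nil; exact/cont_intg/cont_cst.
by under eq_fun do rewrite big_cons; exact: intgD.
Qed.

Lemma itv0S t : t \in `[0, T] -> `[0, t] `<=` `[0, T].
Proof.
rewrite in_itv/= => /andP[t0 tT] x/=; rewrite !in_itv/= => /andP[-> xt].
exact: le_trans xt tT.
Qed.

Lemma intgS f t : t \in `[0, T] -> intg f -> mu.-integrable `[0, t] (EFin \o f).
Proof. by move=> tT; apply: integrableS => //; exact: itv0S. Qed.

Lemma cont_integral f : intg f -> cont (fun t => \int[mu]_(s in `[0, t]) f s)%R.
Proof. by apply: parameterized_integral_continuous; exact: ltW. Qed.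

Lemma Rintegral_sum I (s : seq I) (f : I -> R -> R) t : t \in `[0, T] ->
  (forall i, intg (f i)) ->
  (\int[mu]_(x in `[0, t]) (\sum_(i <- s) f i x) =
   \sum_(i <- s) \int[mu]_(x in `[0, t]) f i x)%R.
Proof.
move=> tT cf; elim: s => [|i s ih].
  rewrite big_nil; under eq_Rintegral do rewrite big_nil.
  by rewrite Rintegral_cst// mul0r.
rewrite big_cons -ih -RintegralD//; [|exact: intgS|].
  by apply: eq_Rintegral => x _; rewrite big_cons.
exact/intgS/intg_sum.
Qed.

Lemma le_int f g t : t \in `[0, T] -> intg f -> intg g ->
  (forall s, s \in `[0, T] -> f s <= g s) ->
  (\int[mu]_(s in `[0, t]) f s <= \int[mu]_(s in `[0, t]) g s)%R.
Proof.
move=> tT F G fg; apply: le_Rintegral => //; [exact: intgS|exact: intgS|].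
by move=> x xt; apply: fg; exact: itv0S xt.
Qed.

Lemma T_in : T \in `[0, T].
Proof. by rewrite in_itv/= lexx (ltW T_gt0). Qed.

Lemma le_int_cst f t B : t \in `[0, T] -> intg f -> 0 <= B ->
  (forall s, s \in `[0, T] -> f s <= B) ->
  (\int[mu]_(s in `[0, t]) f s <= T * B)%R.
Proof.
move=> tT F B0 fB; have tT' := tT; move: tT'; rewrite in_itv/= => /andP[t0 tT'].
apply: (le_trans (le_int _ _ _ tT F (cont_intg _ (cont_cst B)) fB)).
rewrite Rintegral_cst//= lebesgue_measure_itv/= lte_fin; case: ltP => _ /=.
  by rewrite subr0 mulrC ler_wpM2r.
by rewrite mulr0 mulr_ge0// ltW.
Qed.

Lemma le_int_T f t : t \in `[0, T] -> intg f ->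
  (forall s, s \in `[0, T] -> 0 <= f s) ->
  (\int[mu]_(s in `[0, t]) f s <= \int[mu]_(s in `[0, T]) f s)%R.
Proof.
move=> tT F f0; have tT' := tT; move: tT'; rewrite in_itv/= => /andP[t0 tT'].
rewrite -subr_ge0 Rintegral_itvB//.
apply: Rintegral_ge0 => x /=; rewrite in_itv/= => /andP[tx xT].
by apply: f0; rewrite in_itv/= xT (le_trans t0 (ltW tx)).
Qed.

(* The weight [expR (2 * K * t)] turns [f |-> K * \int_0^t f] into a
   contraction of ratio 1/2. *)
Lemma int_weight K B f t : 0 < K -> 0 <= B -> t \in `[0, T] -> intg f ->
  (forall s, s \in `[0, T] -> f s <= B * expR (2 * K * s)) ->
  K * (\int[mu]_(s in `[0, t]) f s)%R <= B / 2 * (expR (2 * K * t) - 1).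
Proof.
move=> K0 B0 tT F fB; have tT' := tT.
move: tT'; rewrite in_itv/= => /andP[t0 tT'].
(* The fundamental theorem of calculus is applied below with [0 < t], so the degenerate interval is
   treated apart. *)
have [->|tn0] := eqVneq t 0.
  by rewrite set_itv1 Rintegral_set1 !mulr0 expR0 subrr mulr0.
have {tn0}t0 : 0 < t by rewrite lt_neqAle eq_sym tn0.
pose e (s : R) := expR (2 * K * s).
have dG (s : R) : is_derive s (1 : R) (fun s : R => (2 * K)^-1 * expR (2 * K * s)) (e s).
  apply: (@is_derive_eq _ _ _ _ _ _ _ _ _).
  rewrite /e /GRing.scale/= mulr1.
  by field; rewrite gt_eqF.
have ce : continuous e.
  move=> s; apply: differentiable_continuous; apply/derivable1_diffP.
  by apply: ex_derive.
have cG : continuous (fun s => (2 * K)^-1 * expR (2 * K * s)).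
  move=> s; apply: differentiable_continuous; apply/derivable1_diffP.
  exact: ex_derive.
have ie : intg e by apply: cont_intg; exact: continuous_subspaceT.
have E : (\int[mu]_(s in `[0, t]) e s)%R = (2 * K)^-1 * (e t - 1).
  rewrite /Rintegral (@continuous_FTC2 _ e (fun s => (2 * K)^-1 * e s))//=.
  - by rewrite /e mulr0 expR0 mulr1 mulrBr mulr1.
  - exact: continuous_subspaceT.
  - split=> //.
    + by apply: cvg_at_right_filter; exact: cG.
    + by apply: cvg_at_left_filter; exact: cG.
  - by move=> x _; rewrite derive1E; case: (dG x).
have := le_int _ _ _ tT F (intgZ B _ ie) fB.
rewrite RintegralZl//; last exact: intgS.
rewrite E => h; rewrite (le_trans (ler_wpM2l (ltW K0) h))// le_eqVlt.
by apply/orP; left; apply/eqP; rewrite /e; field; rewrite gt_eqF.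
Qed.

(** Starting from the bound [M], the hypothesis is iterated: with [e] the exponential weight,
    [int_weight] improves a bound [(2 * a + b) * e] to [(2 * a + b / 2) * e]. In the limit only the
    constant [2 * a] is left. *)
Lemma gronwall K a f : 0 < K -> 0 <= a -> intg f ->
  (exists M, forall t, t \in `[0, T] -> f t <= M) ->
  (forall t, t \in `[0, T] ->
    f t <= a + K * (\int[mu]_(s in `[0, t]) f s)%R) ->
  forall t, t \in `[0, T] -> f t <= 2 * a * expR (2 * K * T).
Proof.
move=> K0 a0 F [M fM] fle.
pose e (s : R) := expR (2 * K * s).
have e1 t : t \in `[0, T] -> 1 <= e t.
  rewrite in_itv/= => /andP[t0 _]; rewrite /e -expR0 ler_expR.
  by rewrite !mulr_ge0// ltW.
have step n t : t \in `[0, T] -> f t <= (2 * a + `|M| / 2 ^+ n) * e t.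
  elim: n t => [|n ih] t tT.
    rewrite expr0 divr1; have := le_trans (fM _ tT) (ler_norm M).
    have := e1 _ tT; have := normr_ge0 M; nra.
  have B0 : 0 <= 2 * a + `|M| / 2 ^+ n.
    by rewrite addr_ge0 ?mulr_ge0// invr_ge0 exprn_ge0.
  apply: (le_trans (fle _ tT)).
  apply: (le_trans (lerD (lexx a) (int_weight _ _ _ _ K0 B0 tT F ih))).
  rewrite -/(e t) exprS invfM; have := e1 _ tT.
  have : 0 <= `|M| / 2 ^+ n by rewrite mulr_ge0// invr_ge0 exprn_ge0.
  rewrite mulrCA; set b := `|M| / _ => b0 et; nra.
move=> t tT.
have et : e t <= e T.
  move: tT; rewrite in_itv/= => /andP[_ tT].
  by rewrite /e ler_expR ler_wpM2l// mulr_ge0// ltW.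
apply: (@le_trans _ _ (2 * a * e t)); last first.
  by rewrite ler_wpM2l// mulr_ge0.
have L : (fun n => (2 * a + `|M| / 2 ^+ n) * e t) @ \oo --> (2 * a) * e t.
  apply: cvgMr_tmp; rewrite -[X in _ --> X]addr0; apply: cvgD; first exact: cvg_cst.
  have := @cvg_geometric R `|M| 2^-1 _.
  rewrite ger0_norm//; have h2 : 2^-1 < 1 :> R by lra.
  move=> /(_ h2); apply: cvg_trans; apply: near_eq_cvg.
  by apply: nearW => n; rewrite /geometric/= exprVn.
rewrite -(cvg_lim _ L)//; apply: limr_ge; first exact: cvgP L.
by apply: nearW => n; exact: step.
Qed.

End Interval.

(** * Linear differential equations with continuous coefficients *)

Section LinearODE.
Context {R : realType} {T : R} (T_gt0 : 0 < T).
Local Notation mu := (@lebesgue_measure R).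
Local Notation cont := (@cont R T).
Local Notation intg := (@intg R T).
Implicit Types (s t : R).

Definition mcont {m n} (M : R -> 'M[R]_(m, n)) :=
  forall i j, cont (fun t => M t i j).
Definition mintg {m n} (M : R -> 'M[R]_(m, n)) :=
  forall i j, intg (fun t => M t i j).

Lemma eq_mcont {m n} (M N : R -> 'M[R]_(m, n)) :
  (forall t, t \in `[0, T] -> M t = N t) -> mcont M -> mcont N.
Proof. by move=> MN cM i j; apply: eq_cont (cM i j) => t /MN ->. Qed.

Lemma mcont_cst {m n} (M : 'M[R]_(m, n)) : mcont (fun=> M).
Proof. by move=> i j; exact: cont_cst. Qed.

Lemma mcontD {m n} (M N : R -> 'M[R]_(m, n)) :
  mcont M -> mcont N -> mcont (fun t => M t + N t).
Proof. by move=> cM cN i j; under eq_fun do rewrite mxE; exact: contD. Qed.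

Lemma mcontB {m n} (M N : R -> 'M[R]_(m, n)) :
  mcont M -> mcont N -> mcont (fun t => M t - N t).
Proof. by move=> cM cN i j; under eq_fun do rewrite !mxE; exact: contB. Qed.

Lemma mcontM {m n k} (M : R -> 'M[R]_(m, n)) (N : R -> 'M[R]_(n, k)) :
  mcont M -> mcont N -> mcont (fun t => M t *m N t).
Proof.
move=> cM cN i j; under eq_fun do rewrite mxE.
by apply: cont_sum => l; exact: contM.
Qed.

Lemma mcont_tr {m n} (M : R -> 'M[R]_(m, n)) :
  mcont M -> mcont (fun t => (M t)^T).
Proof. by move=> cM i j; under eq_fun do rewrite mxE; exact: cM. Qed.

Lemma mcont_n1 {m n} (M : R -> 'M[R]_(m, n)) :
  mcont M -> cont (fun t => n1 (M t)).
Proof. by move=> cM; do 2 (apply: cont_sum => ?); exact: cont_norm. Qed.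

Lemma mcont_bounded {m n} (M : R -> 'M[R]_(m, n)) : mcont M ->
  exists2 K, 0 <= K & forall t, t \in `[0, T] -> n1 (M t) <= K.
Proof. by move=> /mcont_n1; exact: cont_bounded. Qed.

Lemma mcont_mintg {m n} (M : R -> 'M[R]_(m, n)) : mcont M -> mintg M.
Proof. by move=> cM i j; exact: cont_intg. Qed.

Lemma mintgD {m n} (M N : R -> 'M[R]_(m, n)) :
  mintg M -> mintg N -> mintg (fun t => M t + N t).
Proof. by move=> cM cN i j; under eq_fun do rewrite mxE; exact: intgD. Qed.

Lemma mintgB {m n} (M N : R -> 'M[R]_(m, n)) :
  mintg M -> mintg N -> mintg (fun t => M t - N t).
Proof. by move=> cM cN i j; under eq_fun do rewrite !mxE; exact: intgB. Qed.

Lemma mintg_n1 {m n} (M : R -> 'M[R]_(m, n)) :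
  mintg M -> intg (fun t => n1 (M t)).
Proof. by move=> cM; do 2 (apply: intg_sum => ?); exact: intg_norm. Qed.

Definition mint {m n} (M : R -> 'M[R]_(m, n)) t : 'M[R]_(m, n) :=
  \matrix_(i, j) (\int[mu]_(s in `[0, t]) M s i j)%R.

Lemma mcont_mint {m n} (M : R -> 'M[R]_(m, n)) : mintg M -> mcont (mint M).
Proof.
by move=> iM i j; under eq_fun do rewrite mxE; exact: cont_integral.
Qed.

Lemma eq_mint {m n} (M N : R -> 'M[R]_(m, n)) t : t \in `[0, T] ->
  (forall s, s \in `[0, T] -> M s = N s) -> mint M t = mint N t.
Proof.
move=> tT MN; apply/matrixP => i j; rewrite !mxE; apply: eq_Rintegral => s.
by rewrite inE => /(itv0S _ tT) sT; rewrite MN.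
Qed.

Lemma mintB {m n} (M N : R -> 'M[R]_(m, n)) t : t \in `[0, T] ->
  mintg M -> mintg N -> mint (fun s => M s - N s) t = mint M t - mint N t.
Proof.
move=> tT iM iN; apply/matrixP => i j; rewrite !mxE -RintegralB//.
- by apply: eq_Rintegral => s _; rewrite !mxE.
- exact: (intgS _ _ tT (iM i j)).
- exact: (intgS _ _ tT (iN i j)).
Qed.

Lemma mintD {m n} (M N : R -> 'M[R]_(m, n)) t : t \in `[0, T] ->
  mintg M -> mintg N -> mint (fun s => M s + N s) t = mint M t + mint N t.
Proof.
move=> tT iM iN; apply/matrixP => i j; rewrite !mxE -RintegralD//.
- by apply: eq_Rintegral => s _; rewrite !mxE.
- exact: (intgS _ _ tT (iM i j)).
- exact: (intgS _ _ tT (iN i j)).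
Qed.

Lemma mintM {m n k} (M : 'M[R]_(m, n)) (N : R -> 'M[R]_(n, k)) t :
  t \in `[0, T] -> mintg N -> mint (fun s => M *m N s) t = M *m mint N t.
Proof.
move=> tT iN; apply/matrixP => i j; rewrite !mxE.
under eq_Rintegral do rewrite mxE.
rewrite (@Rintegral_sum _ T)//; last by move=> l; exact: intgZ.
by apply: eq_bigr => l _; rewrite mxE RintegralZl//; exact: (intgS _ _ tT (iN l j)).
Qed.

Lemma mint_tr {m n} (M : R -> 'M[R]_(m, n)) t :
  mint (fun s => (M s)^T) t = (mint M t)^T.
Proof.
by apply/matrixP => i j; rewrite !mxE; apply: eq_Rintegral => s; rewrite mxE.
Qed.

Lemma n1_mint {m n} (M : R -> 'M[R]_(m, n)) t : t \in `[0, T] -> mintg M ->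
  n1 (mint M t) <= (\int[mu]_(s in `[0, t]) n1 (M s))%R.
Proof.
move=> tT iM; rewrite (@Rintegral_sum _ T)//; last first.
  by move=> i; apply: intg_sum => j; exact: intg_norm.
apply: ler_sum => i _; rewrite (@Rintegral_sum _ T)//; last first.
  by move=> j; exact: intg_norm.
apply: ler_sum => j _; rewrite mxE; apply: le_normr_Rintegral => //.
exact: (intgS _ _ tT (iM i j)).
Qed.

Lemma solves_odeP {d} (A : R -> 'M[R]_d) (r u : R -> 'cV[R]_d) x0 X :
  solves_ode T A r u x0 X <->
  mintg (fun s => A s *m X s + r s + u s) /\
  forall t, t \in `[0, T] -> X t = x0 + mint (fun s => A s *m X s + r s + u s) t.
Proof.
split=> [S|[I E] i]; last first.
  split; first exact: I.
  by move=> t tT; rewrite {1}E// !mxE.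
split=> [i j|t tT]; first by rewrite (ord1 j); case: (S i).
by apply/matrixP => i j; rewrite (ord1 j) !mxE; case: (S i) => _; exact.
Qed.

(** On [0, T] the trajectory agrees with an indefinite integral of an integrable function, hence is
    continuous however irregular [u] is. *)
Lemma solves_ode_mcont {d} (A : R -> 'M[R]_d) (r u : R -> 'cV[R]_d) x0 X :
  solves_ode T A r u x0 X -> mcont X.
Proof.
move=> /solves_odeP[I E].
apply: (@eq_mcont _ _ (fun t => x0 + mint (fun s => A s *m X s + r s + u s) t)).
  by move=> t /E.
by apply: mcontD; [exact: mcont_cst|exact: mcont_mint].
Qed.

(** Serves the limit in the Picard integral equation. Integrability of the limit is part of the
    conclusion because [solves_ode] asks for it; a constant dominates since the interval has finite
    length. *)
Lemma dominated_cont (f_ : nat -> R -> R) (f : R -> R) (M : R) :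
  (forall n, cont (f_ n)) ->
  (forall s, s \in `[0, T] -> f_ n s @[n --> \oo] --> f s) ->
  (forall n s, s \in `[0, T] -> `|f_ n s| <= M) ->
  intg f /\ forall t, t \in `[0, T] ->
   (\int[mu]_(s in `[0, t]) f_ n s)%R @[n --> \oo] --> (\int[mu]_(s in `[0, t]) f s)%R.
Proof.
move=> cf ff fM.
have mf : measurable_fun `[0, T] (EFin \o f).
  apply/measurable_EFinP; apply: (@measurable_fun_cvg _ _ _ _ f_) => [n|s sT].
    exact: subspace_continuous_measurable_fun (cf n).
  exact: ff.
have D t : t \in `[0, T] -> mu.-integrable `[0, t] (EFin \o f) /\
    (\int[mu]_(s in `[0%R, t]) (f_ n s)%:E)%E @[n --> \oo] -->
    (\int[mu]_(s in `[0%R, t]) (f s)%:E)%E.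
  move=> tT; have := @dominated_convergence _ _ _ mu `[0, t] _
    (fun n => EFin \o f_ n) (EFin \o f) (cst M%:E).
  case.
  - by [].
  - move=> n; apply: measurable_int (intgS _ _ tT (cont_intg _ (cf n))).
  - by apply: measurable_funS mf => //; exact: itv0S.
  - by apply: aeW => s st; apply: cvg_EFin; [exact: nearW|apply: ff; exact: itv0S st].
  - by apply: (intgS _ _ tT (cont_intg _ (cont_cst M))).
  - by apply: aeW => s n st; rewrite lee_fin; apply: fM; exact: itv0S st.
  by [].
have F : intg f by case: (D T (T_in T_gt0)).
split=> // t tT; apply: fine_cvg; rewrite fineK; first by case: (D t tT).
by apply: integrable_fin_num => //; case: (D t tT).
Qed.

(** The increments are summable by comparison with a geometric series, and the sequence is their
    telescoping sum. *)
Lemma cvg_half_steps (u : nat -> R) (B : R) :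
  (forall n, `|u n.+1 - u n| <= B / 2 ^+ n) -> cvgn u.
Proof.
move=> uB; have B0 : 0 <= B.
  by have := uB 0%N; rewrite expr0 divr1; exact: le_trans.
have C : cvgn (series (fun n => u n.+1 - u n)).
  apply: normed_cvg; apply: (@series_le_cvg _ _ (geometric B 2^-1)).
  - by move=> n /=; exact: normr_ge0.
  - by move=> n; rewrite /geometric/= mulr_ge0// exprn_ge0// invr_ge0//.
  - by move=> n; rewrite /geometric/= exprVn.
  - by apply: is_cvg_geometric_series; rewrite ger0_norm//; lra.
have -> : u = (fun n => u 0%N + series (fun n => u n.+1 - u n) n).
  apply/funext => n; rewrite /series/= telescope_sumr//.
  by rewrite addrCA subrr addr0.
by apply: is_cvgD => //; exact: is_cvg_cst.
Qed.

(** * Global existence by Picard iteration *)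

Section Picard.
Context {d : nat} (A : R -> 'M[R]_d) (r : R -> 'cV[R]_d) (x0 : 'cV[R]_d).
Hypotheses (cA : mcont A) (cr : mcont r).

(** Starting from 0 rather than [x0] makes the first increment equal to the first iterate, so one
    constant bounds both iterates and increments. *)
Fixpoint picard n : R -> 'cV[R]_d :=
  if n is n'.+1 then fun t => x0 + mint (fun s => A s *m picard n' s + r s) t
  else fun=> 0.

Lemma picard_mcont n : mcont (picard n).
Proof.
elim: n => [|n ih]/=; first exact: mcont_cst.
apply: mcontD; first exact: mcont_cst.
by apply/mcont_mint/mcont_mintg/mcontD => //; exact: mcontM.
Qed.

(** With the weight [expR (2 * K * t)] the iteration is a contraction of ratio 1/2 on the whole of
    [0, T], so no short intervals have to be glued. The affine part is at most [B / 2], hence the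
    weighted ball of radius [B] is preserved and the increments halve. *)
Lemma picard_bounds : exists B,
  (forall n t, t \in `[0, T] -> n1 (picard n t) <= B) /\
  (forall n t, t \in `[0, T] -> n1 (picard n.+1 t - picard n t) <= B / 2 ^+ n).
Proof.
have [K0 K0_ge0 AK] := mcont_bounded _ cA.
have [F F_ge0 rF] := mcont_bounded _ cr.
(* Adding 1 makes [K] positive, as [int_weight] requires. *)
pose K := K0 + 1; have K_gt0 : 0 < K by rewrite /K ltr_wpDl.
pose B := 2 * (n1 x0 + T * F).
have B0 : 0 <= B by rewrite !(mulr_ge0, addr_ge0) ?n1_ge0// ltW.
pose e t := expR (2 * K * t).
have e1 t : t \in `[0, T] -> 1 <= e t.
  rewrite in_itv/= => /andP[t0 _]; rewrite /e -expR0 ler_expR.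
  by rewrite !mulr_ge0// ltW.
have eT t : t \in `[0, T] -> e t <= e T.
  rewrite in_itv/= => /andP[_ tT].
  by rewrite /e ler_expR ler_wpM2l// mulr_ge0// ltW.
have AX (X : R -> 'cV[R]_d) t : mcont X -> t \in `[0, T] ->
    n1 (mint (fun s => A s *m X s) t) <= K * (\int[mu]_(s in `[0, t]) n1 (X s))%R.
  move=> cX tT; apply: (le_trans (n1_mint _ _ tT _)).
    by apply/mcont_mintg/mcontM.
  have iX : intg (fun s => n1 (X s)) by apply/cont_intg/mcont_n1.
  rewrite -RintegralZl//; last exact: (intgS _ _ tT iX).
  apply: (le_int _ _ _ tT); [|exact: (intgZ _ _ iX)|].
    by apply/cont_intg/mcont_n1/mcontM.
  move=> s sT; apply: (le_trans (n1_mul _ _)); rewrite ler_wpM2r ?n1_ge0//.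
  by rewrite (le_trans (AK _ sT))// /K lerDl.
have P1 n t : t \in `[0, T] -> n1 (picard n t) <= B * e t.
  elim: n t => [|n ih] t tT /=.
    by rewrite n1_0 mulr_ge0// (le_trans _ (e1 t tT)).
  have c1 : mcont (fun s => A s *m picard n s).
    by apply: mcontM => //; exact: picard_mcont.
  rewrite mintD//; [|exact: mcont_mintg|exact: mcont_mintg].
  rewrite (le_trans (n1D _ _))//.
  have h1 := AX _ _ (picard_mcont n) tT.
  have h2 := int_weight _ _ _ _ K_gt0 B0 tT
    (cont_intg _ (mcont_n1 _ (picard_mcont n))) ih.
  have h3 : n1 (mint r t) <= T * F.
    apply: (le_trans (n1_mint _ _ tT (mcont_mintg _ cr))).
    by apply: le_int_cst => //; exact/cont_intg/mcont_n1.
  have := n1D (mint (fun s => A s *m picard n s) t) (mint r t).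
  have := e1 _ tT; rewrite -/(e t) in h2; rewrite /B in h2 B0 *; nra.
have P2 n t : t \in `[0, T] ->
    n1 (picard n.+1 t - picard n t) <= B / 2 ^+ n * e t.
  elim: n t => [|n ih] t tT.
    by rewrite subr0 expr0 divr1; exact: P1.
  have Bn : 0 <= B / 2 ^+ n by rewrite divr_ge0// exprn_ge0.
  have -> : picard n.+2 t - picard n.+1 t =
      mint (fun s => A s *m picard n.+1 s + r s) t -
      mint (fun s => A s *m picard n s + r s) t.
    by rewrite /= opprD addrACA subrr add0r.
  rewrite -mintB//; first last.
  - by apply/mcont_mintg/mcontD => //; apply: mcontM => //; exact: picard_mcont.
  - by apply/mcont_mintg/mcontD => //; apply: mcontM => //; exact: picard_mcont.
  rewrite (@eq_mint _ _ _ (fun s => A s *m (picard n.+1 s - picard n s)))//; last first.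
    by move=> s _; rewrite opprD addrACA subrr addr0 mulmxBr.
  have cD : mcont (fun s => picard n.+1 s - picard n s)
    by apply: mcontB; exact: picard_mcont.
  apply: (le_trans (AX _ _ cD tT)).
  apply: (le_trans (int_weight _ _ _ _ K_gt0 Bn tT
    (cont_intg _ (mcont_n1 _ cD)) ih)).
  rewrite -/(e t) exprS invfM; have := e1 _ tT; set b := B / _ in Bn * => et.
  rewrite mulrCA -/b; nra.
exists (B * e T); split=> n t tT.
  by rewrite (le_trans (P1 n t tT))// ler_wpM2l// eT.
rewrite (le_trans (P2 n t tT))// [leRHS]mulrAC ler_wpM2l ?eT//.
by rewrite divr_ge0// exprn_ge0.
Qed.

(** The solution is the pointwise limit of the iterates: the uniform bounds give dominated
    convergence of the integrals, so both sides of the integral equation are limits of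
    [picard n.+1]. *)
Lemma ode_exists : exists X, solves_ode T A r (fun=> 0) x0 X.
Proof.
have [B [PB PS]] := picard_bounds.
have cv t : t \in `[0, T] -> forall i, cvgn (fun n => picard n t i 0).
  move=> tT i; apply: (@cvg_half_steps _ B) => n.
  apply: le_trans (PS n t tT).
  by have := n1_entry (picard n.+1 t - picard n t) i 0; rewrite !mxE.
(* Convergence is known on [0, T] only; the values of [X] elsewhere do not enter [solves_ode]. *)
pose X t : 'cV[R]_d := \col_i limn (fun n => picard n t i 0).
have [K K_ge0 AK] := mcont_bounded _ cA.
have [F F_ge0 rF] := mcont_bounded _ cr.
have D i := @dominated_cont (fun n t => (A t *m picard n t + r t) i 0)
  (fun t => (A t *m X t + r t) i 0) (K * B + F).
exists X; apply/solves_odeP.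
have {}D i : intg (fun t => (A t *m X t + r t) i 0) /\ forall t, t \in `[0, T] ->
   (\int[mu]_(s in `[0, t]) (A s *m picard n s + r s) i 0)%R @[n --> \oo] -->
   (\int[mu]_(s in `[0, t]) (A s *m X s + r s) i 0)%R.
  apply: D => [n|s sT|n s sT].
  - by apply: mcontD => //; apply: mcontM => //; exact: picard_mcont.
  - under eq_fun do rewrite !mxE; rewrite !mxE.
    apply: cvgD; last exact: cvg_cst.
    apply: cvg_big => [|l _]; first exact: add_continuous.
    apply: cvgMl_tmp; rewrite mxE; exact: cv.
  - apply: (le_trans (n1_entry _ _ _)); apply: (le_trans (n1D _ _)).
    apply: lerD; last exact: rF.
    by apply: (le_trans (n1_mul _ _)); rewrite ler_pM ?n1_ge0// ?AK// PB.
split=> [i j|t tT].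
  by rewrite (ord1 j); under eq_fun do rewrite addr0; case: (D i).
apply/matrixP => i j; rewrite (ord1 j) [RHS]mxE.
have c1 : picard n.+1 t i 0 @[n --> \oo] --> X t i 0.
  rewrite mxE; have := cv t tT i.
  by rewrite -(cvg_shiftS (fun n => picard n t i 0)).
apply: (cvg_unique _ c1) => //=.
under eq_fun do rewrite !mxE.
apply: cvgD; first exact: cvg_cst.
have -> : mint (fun s => A s *m X s + r s + 0) t i 0 =
    (\int[mu]_(s in `[0, t]) (A s *m X s + r s) i 0)%R.
  by rewrite mxE; apply: eq_Rintegral => s _; rewrite addr0.
exact: (D i).2.
Qed.

End Picard.
End LinearODE.

(** * Perturbation of solutions and coercivity of the output *)

Section Observability.
Context {R : realType} {T : R} (T_gt0 : 0 < T).
Local Notation mu := (@lebesgue_measure R).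
Local Notation cont := (@cont R T).
Local Notation intg := (@intg R T).
Local Notation mcont := (@mcont R T _ _).
Local Notation mintg := (@mintg R T _ _).
Implicit Types (s t : R).

Let TT : T \in `[0, T] := T_in T_gt0.

Lemma mintMr {m n k} (M : R -> 'M[R]_(m, n)) (N : 'M[R]_(n, k)) t :
  t \in `[0, T] -> mintg M -> mint (fun s => M s *m N) t = mint M t *m N.
Proof.
move=> tT iM; apply: trmx_inj; rewrite -mint_tr trmx_mul -mint_tr.
rewrite -(@mintM _ T)//; last first.
  by move=> i j; under eq_fun do rewrite mxE; exact: iM.
by apply: (@eq_mint _ T) => // s _; rewrite trmx_mul.
Qed.

(** The difference satisfies [(X - Z)' = A' (X - Z) + (A' - A) Z + (r' - r) + u] with zero initial
    value, and Gronwall applies. In this splitting the perturbation [A' - A] acts on [Z], whose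
    bound [c] is given, and not on [X]. *)
Lemma ode_perturb {d} (A A' : R -> 'M[R]_d) (r r' u X Z : R -> 'cV[R]_d)
    (x0 : 'cV[R]_d) (K eta c delta : R) :
  0 < K -> 0 <= eta -> 0 <= c -> 0 <= delta ->
  mcont A -> mcont A' -> mcont r -> mcont r' ->
  solves_ode T A' r' u x0 X -> solves_ode T A r (fun=> 0) x0 Z -> mintg u ->
  (forall t, t \in `[0, T] -> n1 (A' t) <= K) ->
  (forall t, t \in `[0, T] -> n1 (A' t - A t) <= eta) ->
  (forall t, t \in `[0, T] -> n1 (r' t - r t) <= eta) ->
  (forall t, t \in `[0, T] -> n1 (Z t) <= c) ->
  (\int[mu]_(s in `[0, T]) n1 (u s))%R <= delta ->
  forall t, t \in `[0, T] ->
    n1 (X t - Z t) <= 2 * (T * (eta * (c + 1)) + delta) * expR (2 * K * T).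
Proof.
move=> K0 eta0 c0 delta0 cA cA' cr cr' SX SZ iu A'K A'A r'r Zc udelta.
have cX := solves_ode_mcont T_gt0 _ _ _ _ _ SX.
have cZ := solves_ode_mcont T_gt0 _ _ _ _ _ SZ.
move: SX SZ => /solves_odeP[IX EX] /solves_odeP[IZ EZ].
have cD : mcont (fun t => X t - Z t) by exact: (mcontB _ _ cX cZ).
have iD : intg (fun t => n1 (X t - Z t)) by apply/cont_intg/mcont_n1.
have in1u := mintg_n1 _ iu.
apply: gronwall => //.
- by rewrite addr_ge0// mulr_ge0 ?(ltW T_gt0)// mulr_ge0// addr_ge0.
- by have [M _ h] := mcont_bounded T_gt0 _ cD; exists M.
move=> t tT; rewrite EX// EZ// opprD addrACA subrr add0r -(@mintB _ T)//.
apply: (le_trans (n1_mint _ _ tT (mintgB _ _ IX IZ))).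
have ic : intg (fun=> eta * (c + 1)) by apply/cont_intg/cont_cst.
apply: (@le_trans _ _ (\int[mu]_(s in `[0, t])
   ((eta * (c + 1) + n1 (u s)) + K * n1 (X s - Z s)))%R).
  apply: (le_int _ _ _ tT).
  - exact/mintg_n1/mintgB.
  - by apply: intgD; [exact: intgD|exact: intgZ].
  move=> s sT.
  have -> : A' s *m X s + r' s + u s - (A s *m Z s + r s + 0) =
      A' s *m (X s - Z s) + (A' s - A s) *m Z s + (r' s - r s) + u s.
    by rewrite mulmxBr mulmxBl; apply/matrixP => i j; rewrite !mxE; ring.
  apply: (le_trans (n1D _ _)); rewrite [leRHS]addrAC lerD2r.
  apply: (le_trans (n1D _ _)); apply: (@le_trans _ _
    ((K * n1 (X s - Z s) + eta * c) + eta)); last first.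
    by rewrite mulrDr mulr1 [leRHS]addrC addrA.
  apply: lerD; last exact: r'r.
  apply: (le_trans (n1D _ _)); apply: lerD; apply: (le_trans (n1_mul _ _)).
    by rewrite ler_wpM2r ?n1_ge0 ?A'K.
  by rewrite ler_pM ?n1_ge0 ?A'A ?Zc.
rewrite RintegralD//; last 2 first.
- exact: (intgS _ _ tT (intgD _ _ ic in1u)).
- exact: (intgS _ _ tT (intgZ K _ iD)).
rewrite RintegralZl//; last exact: (intgS _ _ tT iD).
rewrite lerD2r RintegralD//; last 2 first.
- exact: (intgS _ _ tT ic).
- exact: (intgS _ _ tT in1u).
apply: lerD.
  apply: le_int_cst => //; rewrite ?mulr_ge0 ?addr_ge0//.
by apply: le_trans udelta; apply: le_int_T => // s _; exact: n1_ge0.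
Qed.

(** If [f t] were positive, continuity would keep [f] above [f t / 2] on an interval of positive
    length, and nonnegativity elsewhere could not compensate its integral. *)
Lemma cont_int_eq0 (f : R -> R) : cont f ->
  (forall t, t \in `[0, T] -> 0 <= f t) -> (\int[mu]_(s in `[0, T]) f s)%R = 0 ->
  forall t, t \in `[0, T] -> f t = 0.
Proof.
move=> cf f0 If0 t tT; apply/eqP/negP => /negP ft0.
have {}ft0 : 0 < f t by rewrite lt_neqAle eq_sym ft0 f0.
have iF := cont_intg _ cf.
have [e e0 he] : exists2 e : R, 0 < e &
    forall s, s \in `[0, T] -> `|t - s| < e -> f t / 2 <= f s.
  have /subspace_continuousP/(_ t tT) := cf.
  move=> /cvgrPdist_le/(_ (f t / 2)); rewrite divr_gt0// => /(_ isT).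
  rewrite near_withinE => -[e/= e0 h]; exists e => // s sT ts.
  have := h s ts sT; rewrite ler_norml => /andP[_ hs].
  have {}hs : f t - f s <= f t / 2 := hs; lra.
have := tT; rewrite in_itv/= => /andP[t0 tT'].
(* Clipping at 0 and [T] covers the case where [t] is an endpoint; the half radius keeps every point
   of []a, b]] at distance less than [e] from [t]. *)
pose a : R := Num.max 0 (t - e / 2); pose b : R := Num.min T (t + e / 2).
have a0 : 0 <= a by rewrite le_max lexx.
have bT : b <= T by rewrite ge_min lexx.
have ab : a < b by rewrite gt_max !lt_min; rewrite T_gt0/=; apply/and3P; split; lra.
have aT : a \in `[0, T] by rewrite in_itv/= a0 (le_trans (ltW ab)).
have bT' : b \in `[0, T] by rewrite in_itv/= bT (le_trans a0 (ltW ab)).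
have h1 := le_int_T _ _ bT' iF f0; rewrite If0 in h1.
have h2 : 0 <= (\int[mu]_(s in `[0, a]) f s)%R.
  by apply: Rintegral_ge0 => s /(itv0S _ aT)/f0.
have h3 : (\int[mu]_(s in `]a, b]) f s)%R <= 0.
  rewrite -(Rintegral_itvB (intgS _ _ bT' iF)) ?bnd_simp//; last exact: ltW.
  by rewrite subr_le0 (le_trans h1).
have sub : `]a, b] `<=` `[0, T].
  move=> s/=; rewrite !in_itv/= => /andP[as_ sb].
  by rewrite (le_trans a0 (ltW as_)) (le_trans sb bT).
have : (\int[mu]_(s in `]a, b]) (f t / 2))%R <= (\int[mu]_(s in `]a, b]) f s)%R.
  apply: le_Rintegral => //.
  - apply: (@integrableS _ _ _ mu _ _ _ _ _ sub) => //.
    exact: (@cont_intg _ T _ (cont_cst (f t / 2))).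
  - by apply: (@integrableS _ _ _ mu _ _ _ _ _ sub).
  move=> s sab; apply: he; first exact: sub.
  move: sab => /=; rewrite in_itv/= => /andP[].
  rewrite gt_max le_min => /andP[_ h] /andP[_ h'].
  by rewrite ltr_norml; apply/andP; split; lra.
rewrite Rintegral_cst//= lebesgue_measure_itv/= lte_fin ab/= => h4.
by have := le_trans h4 h3; rewrite leNgt mulr_gt0 ?subr_gt0 ?divr_gt0.
Qed.

(** The matrix of L2 inner products of the columns of [M]; for [M = C Phi] it is the observability
    Gramian. *)
Definition gram {m n} (M : R -> 'M[R]_(m, n)) := mint (fun t => (M t)^T *m M t) T.

(** With [G] the Gramian, [v^T G v] is the integral of the squared Euclidean norm of [M t *m v];
    when it vanishes, so does its continuous nonnegative integrand. *)
Lemma gram_kernel {m n} (M : R -> 'M[R]_(m, n)) (v : 'cV[R]_n) : mcont M ->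
  gram M *m v = 0 -> forall t, t \in `[0, T] -> M t *m v = 0.
Proof.
move=> cM Gv0 t tT.
have cMv : mcont (fun t => M t *m v) by apply: mcontM => //; exact: mcont_cst.
have cMM : mcont (fun t => (M t)^T *m M t) by apply: mcontM => //; exact: mcont_tr.
have cq : mcont (fun t => (M t *m v)^T *m (M t *m v)).
  by apply: mcontM => //; exact: mcont_tr.
have qE s : ((M s *m v)^T *m (M s *m v)) 0 0 = \sum_i (M s *m v) i 0 ^+ 2.
  by rewrite mxE; apply: eq_bigr => i _; rewrite mxE expr2.
have q0 : ((M t *m v)^T *m (M t *m v)) 0 0 = 0.
  apply: (cont_int_eq0 _ (cq 0 0)) => //.
    by move=> s _; rewrite qE sumr_ge0// => i _; rewrite sqr_ge0.
  have E0 : (v^T *m (gram M *m v)) 0 0 = 0 by rewrite Gv0 mulmx0 mxE.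
  rewrite -[RHS]E0.
  rewrite /gram -(@mintMr _ _ _ _ _ _ TT (mcont_mintg _ cMM)).
  rewrite -(@mintM _ T)//; last first.
    by apply: mcont_mintg; apply: mcontM => //; exact: mcont_cst.
  by rewrite [RHS]mxE; apply: eq_Rintegral => s _; rewrite trmx_mul !mulmxA.
apply/matrixP => i j; rewrite (ord1 j) [RHS]mxE.
move: q0; rewrite qE => /eqP; rewrite psumr_eq0 => [/allP/(_ i)|k _].
  by rewrite mem_index_enum /= sqrf_eq0 => /(_ isT)/eqP.
by rewrite sqr_ge0.
Qed.

(** A singular matrix has a left null vector; symmetry of the Gramian turns it into a right one. *)
Lemma gram_unit {m n} (M : R -> 'M[R]_(m, n)) :
  (forall v : 'cV[R]_n, gram M *m v = 0 -> v = 0) -> gram M \in unitmx.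
Proof.
move=> inj; rewrite unitmxE unitfE; apply/negP => /det0P[w w0 wG].
have GT : (gram M)^T = gram M.
  rewrite /gram -mint_tr; congr mint; apply/funext => s.
  by rewrite trmx_mul trmxK.
move/negP: w0; apply; rewrite -[w]trmxK; apply/eqP.
by rewrite (inj w^T) ?trmx0// -[X in X *m _]GT -trmx_mul wG trmx0.
Qed.

(** Writing [v] as the inverse Gramian applied to the integral of [M^T (M v)] and taking norms gives
    an explicit constant. The bound is in L1, the form in which the cost is exploited later. *)
Lemma gram_coercive {m n} (M : R -> 'M[R]_(m, n)) : mcont M ->
  gram M \in unitmx ->
  exists2 c, 0 <= c & forall v : 'cV[R]_n,
    n1 v <= c * (\int[mu]_(t in `[0, T]) n1 (M t *m v))%R.
Proof.
move=> cM Gu; have cMt := mcont_tr _ cM.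
have [B B0 MB] := mcont_bounded T_gt0 _ cMt.
exists (n1 (invmx (gram M)) * B) => [|v]; first by rewrite mulr_ge0// n1_ge0.
have cMv : mcont (fun t => M t *m v) by apply: mcontM => //; exact: mcont_cst.
have cMMv : mcont (fun t => (M t)^T *m (M t *m v)) by exact: mcontM.
have iMv : intg (fun t => n1 (M t *m v)) by apply/cont_intg/mcont_n1.
rewrite -{1}(mulKmx Gu v); apply: (le_trans (n1_mul _ _)).
rewrite -mulrA ler_wpM2l ?n1_ge0//.
have -> : gram M *m v = mint (fun t => (M t)^T *m (M t *m v)) T.
  rewrite /gram -(@mintMr _ _ _ _ _ _ TT); last exact/mcont_mintg/mcontM.
  by apply: (@eq_mint _ T) => // s _; rewrite mulmxA.
apply: (le_trans (n1_mint _ _ TT (mcont_mintg _ cMMv))).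
rewrite -RintegralZl//; apply: (le_int _ _ _ TT).
- exact/cont_intg/mcont_n1.
- exact: intgZ.
by move=> s sT; apply: (le_trans (n1_mul _ _)); rewrite ler_wpM2r ?n1_ge0 ?MB.
Qed.

(** The columns are the solutions of the homogeneous equation started at the basis vectors. *)
Lemma resolvent_exists {d} (A : R -> 'M[R]_d) : mcont A ->
  exists Phi, is_resolvent T A Phi /\ mcont Phi /\
    forall t, t \in `[0, T] -> Phi t = 1%:M + mint (fun s => A s *m Phi s) t.
Proof.
move=> cA.
have [X SX] := choice (fun j => ode_exists T_gt0 _ _ (delta_mx j 0) cA (mcont_cst 0)).
pose Phi t : 'M[R]_d := \matrix_(i, j) X j t i 0.
have E i j s : (A s *m Phi s) i j = (A s *m X j s + 0 + 0) i 0.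
  by rewrite !addr0 !mxE; apply: eq_bigr => l _; rewrite mxE.
have Res : is_resolvent T A Phi.
  move=> i j; have [I S] := SX j i; split.
    by apply: (@eq_intg _ T _ _ _ I) => s _; rewrite E.
  move=> t tT.
  rewrite mxE S// !mxE andbT; congr (_ + _).
  by apply: eq_Rintegral => s _; rewrite E.
exists Phi; split=> //; split.
  move=> i j; under eq_fun do rewrite mxE.
  exact: (solves_ode_mcont T_gt0 _ _ _ _ _ (SX j)).
by move=> t tT; apply/matrixP => i j; rewrite (Res i j).2// !mxE.
Qed.

(* The [1 + n1 x0] comes from coercivity of the Gramian of the
   augmented output [s, x0 |-> s (C xi - Y) + C Phi x0], where [xi] is a
   particular solution. *)
Lemma output_gap {d d'} (C : 'M[R]_(d', d)) (A : R -> 'M[R]_d)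
    (r : R -> 'cV[R]_d) (Y : R -> 'cV[R]_d') :
  mcont A -> mcont r -> mcont Y ->
  (forall Phi, is_resolvent T A Phi -> gramian T C Phi \in unitmx) ->
  (forall x0 X, solves_ode T A r (fun=> 0) x0 X ->
     ~ forall t, t \in `[0, T] -> C *m X t = Y t) ->
  exists (Z : 'cV[R]_d -> R -> 'cV[R]_d) (c : R), 0 <= c /\
    forall x0, [/\ solves_ode T A r (fun=> 0) x0 (Z x0),
      forall t, t \in `[0, T] -> n1 (Z x0 t) <= c * (1 + n1 x0) &
      1 + n1 x0 <= c * (\int[mu]_(t in `[0, T]) n1 (C *m Z x0 t - Y t))%R].
Proof.
move=> cA cr cY obs noX.
have [Phi [Res [cPhi PhiE]]] := resolvent_exists _ cA.
have [xi Sxi] := ode_exists T_gt0 _ _ 0 cA cr.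
have cxi := solves_ode_mcont T_gt0 _ _ _ _ _ Sxi.
move: Sxi => /solves_odeP[Ixi Exi].
have cAPhi : mcont (fun s => A s *m Phi s) by exact: mcontM.
pose Z x0 t := Phi t *m x0 + xi t.
have SZ x0 : solves_ode T A r (fun=> 0) x0 (Z x0).
  have cAPx : mcont (fun s => A s *m Phi s *m x0).
    by apply: mcontM => //; exact: mcont_cst.
  have E s : A s *m Z x0 s + r s + 0 =
      A s *m Phi s *m x0 + (A s *m xi s + r s + 0).
    by rewrite /Z mulmxDr !mulmxA !addrA.
  apply/solves_odeP; under eq_fun do rewrite E.
  split; first by apply: mintgD => //; exact: mcont_mintg.
  move=> t tT; rewrite /Z PhiE// Exi// add0r mulmxDl mul1mx -addrA; congr (_ + _).
  rewrite -(@mintMr _ _ _ _ _ _ tT (mcont_mintg _ cAPhi)).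
  by rewrite -(@mintD _ T)//; exact: mcont_mintg.
pose M t := row_mx (C *m xi t - Y t) (C *m Phi t).
have cCPhi : mcont (fun t => C *m Phi t) by apply: mcontM => //; exact: mcont_cst.
have cM : mcont M.
  have cN : mcont (fun t => C *m xi t - Y t).
    by apply: mcontB => //; apply: mcontM => //; exact: mcont_cst.
  move=> i j; case: (split_ordP j) => k ->; rewrite /M.
    by under eq_fun do rewrite row_mxEl; exact: cN.
  by under eq_fun do rewrite row_mxEr; exact: cCPhi.
have ME t (a : R) (x : 'cV[R]_d) :
    M t *m col_mx (a%:M : 'M[R]_1) x = a *: (C *m xi t - Y t) + C *m Phi t *m x.
  by rewrite mul_row_col mul_mx_scalar.
have Gu : gram M \in unitmx.
  apply: gram_unit => v /(gram_kernel M v cM) Mv0.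
  have vE : v = col_mx (usubmx v 0 0)%:M (dsubmx v).
    by rewrite -mx11_scalar vsubmxK.
  rewrite vE in Mv0 *; set a := usubmx v 0 0 in Mv0 *.
  set x := dsubmx v in Mv0 *.
  (* If [a] is nonzero, dividing by it produces an initial condition whose output is exactly [Y],
     against [noX]. If [a = 0], then [C Phi x] vanishes identically and nonsingularity of the
     observability Gramian gives [x = 0]. *)
  have [a0|a0] := eqVneq a 0; last first.
    exfalso; apply: (noX _ _ (SZ (a^-1 *: x))) => t tT.
    have := Mv0 t tT; rewrite ME => /(congr1 (fun w => a^-1 *: w)).
    rewrite scaler0 scalerDr scalerA mulVf// scale1r => /eqP.
    rewrite addrAC subr_eq0 => /eqP <-.
    by rewrite /Z mulmxDr mulmxA -scalemxAr addrC.
  suff -> : x = 0 by rewrite a0 raddf0 col_mx0.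
  have gE : gramian T C Phi = gram (fun t => C *m Phi t).
    apply/matrixP => i j; rewrite !mxE; apply: eq_Rintegral => s _.
    by rewrite trmx_mul !mulmxA.
  have := obs Phi Res; rewrite gE => Pu; rewrite -(mulKmx Pu x).
  suff -> : gram (fun t => C *m Phi t) *m x = 0 by rewrite mulmx0.
  rewrite /gram -(@mintMr _ _ _ _ _ _ TT); last first.
    by apply/mcont_mintg/mcontM => //; exact: mcont_tr.
  rewrite (@eq_mint _ T _ _ _ (fun=> 0))//.
    by apply/matrixP => i j; rewrite !mxE Rintegral_cst// mul0r.
  move=> s sT; have := Mv0 s sT; rewrite ME a0 scale0r add0r => h.
  by rewrite -mulmxA h mulmx0.
have [c1 c1_ge0 Mc1] := gram_coercive M cM Gu.
have [K1 K1_ge0 PhiK] := mcont_bounded T_gt0 _ cPhi.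
have [K2 K2_ge0 xiK] := mcont_bounded T_gt0 _ cxi.
(* A single constant for both bounds: [c1] comes from coercivity, [K1] and [K2] control the growth
   of [Z x0]. *)
exists Z, (c1 + K1 + K2); split; first by rewrite !addr_ge0.
move=> x0; split=> [//|t tT|].
  apply: (le_trans (n1D _ _)).
  have h1 : n1 (Phi t *m x0) <= K1 * n1 x0.
    by apply: (le_trans (n1_mul _ _)); rewrite ler_wpM2r ?n1_ge0 ?PhiK.
  have := xiK t tT; have := n1_ge0 x0; nra.
have I0 : 0 <= (\int[mu]_(t in `[0, T]) n1 (C *m Z x0 t - Y t))%R.
  by apply: Rintegral_ge0 => s _; exact: n1_ge0.
apply: (@le_trans _ _ (c1 * (\int[mu]_(t in `[0, T]) n1 (C *m Z x0 t - Y t))%R)).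
  (* With first coordinate 1, the augmented output is [C Z - Y]. *)
  have := Mc1 (col_mx (1%:M : 'M[R]_1) x0).
  rewrite n1_col_mx {1}/n1 !big_ord1 mxE normr1.
  congr (_ <= _ * _); apply: eq_Rintegral => s _; congr n1.
  by rewrite ME scale1r /Z mulmxDr mulmxA addrC addrA.
by rewrite ler_wpM2r// -addrA lerDl addr_ge0.
Qed.
End Observability.

(** * Uniformity in the parameter and control by the cost *)

Section CostControl.
Context {R : realType} {T : R} (T_gt0 : 0 < T).
Local Notation mu := (@lebesgue_measure R).
Local Notation cont := (@cont R T).
Local Notation intg := (@intg R T).
Local Notation mcont := (@mcont R T _ _).
Local Notation mintg := (@mintg R T _ _).
Implicit Types (s t : R).

Lemma n1_cvg {I : Type} {F : set_system I} {FF : Filter F} {m n}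
    (f : I -> 'M[R]_(m, n)) (M : 'M[R]_(m, n)) :
  f x @[x --> F] --> M -> n1 (f x - M) @[x --> F] --> 0.
Proof.
move=> fM; rewrite -[X in _ --> X](@n1_0 R m n) /n1.
apply: cvg_big => [|i _]; first exact: add_continuous.
apply: cvg_big => [|j _]; first exact: add_continuous.
rewrite mxE; under eq_fun do rewrite !mxE.
apply: cvg_norm; rewrite -[X in _ --> X](subrr (M i j)).
apply: cvgB; last exact: cvg_cst.
apply: (@cvg_comp _ _ _ f (fun N : 'M[R]_(m, n) => N i j) _ _ _ fM).
exact: coord_continuous.
Qed.

Section Family.
Context {p m n : nat} (Theta : set 'cV[R]_p) (F : 'cV[R]_p -> R -> 'M[R]_(m, n)).
Hypothesis cF : {within [set tz : R * 'cV[R]_p | tz.1 \in `[0%R, T] /\ Theta tz.2],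
  continuous (fun tz : R * 'cV[R]_p => F tz.2 tz.1)}.

Lemma family_close_at theta t eta : Theta theta -> t \in `[0, T] -> 0 < eta ->
  \forall t' \near t & theta' \near theta, t' \in `[0, T] -> Theta theta' ->
    n1 (F theta' t' - F theta t) <= eta.
Proof.
move=> Th tT eta0.
have /subspace_continuousP/(_ (t, theta) (conj tT Th)) /n1_cvg := cF.
move=> /cvgrPdist_le/(_ eta eta0); rewrite near_withinE => -[[U V] [/= nU nV] UV].
exists (U, V) => // -[t' th'] /= [Ut Vt] t'T Th'.
have := UV (t', th') (conj Ut Vt) (conj t'T Th').
by rewrite sub0r normrN ger0_norm ?n1_ge0.
Qed.

Lemma family_mcont theta : Theta theta -> mcont (F theta).
Proof.
move=> Th i j; apply/subspace_continuousP => t tT.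
apply/cvgrPdist_le => eta eta0; rewrite near_withinE.
have [[U V] [/= nU nV] UV] := family_close_at _ _ _ Th tT eta0.
apply: filterS nU => t' Ut' t'T.
have := UV (t', theta) (conj Ut' (nbhs_singleton nV)) t'T Th.
apply: le_trans; rewrite distrC.
by have := n1_entry (F theta t' - F theta t) i j; rewrite !mxE.
Qed.

(** Uniformity in time comes from compactness of [0, T], in its near-covering form. Both
    [F theta' t'] and [F theta t'] are compared with the value at the centre [(t, theta)] of a
    neighbourhood, whence [eta / 2]. *)
Lemma family_close theta eta : Theta theta -> 0 < eta ->
  \forall theta' \near theta, Theta theta' ->
    forall t, t \in `[0, T] -> n1 (F theta' t - F theta t) <= eta.
Proof.
move=> Th eta0.
pose close theta' t := Theta theta' -> t \in `[0, T] ->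
  n1 (F theta' t - F theta t) <= eta.
have /compact_near_coveringP K := @segment_compact R 0 T.
suff H : \forall theta' \near theta, `[0, T] `<=` close theta'.
  by apply: filterS H => th' h Th' t tT; exact: h.
apply: (K _ (nbhs theta) close (nbhs_filter theta)).
move=> t tT; have eta2 : 0 < eta / 2 by rewrite divr_gt0.
have [[U V] [/= nU nV] UV] := family_close_at _ _ _ Th tT eta2.
exists (U, V) => // -[t' th'] /= [Ut Vt] Th' t'T.
have h1 := UV (t', th') (conj Ut Vt) t'T Th'.
have h2 := UV (t', theta) (conj Ut (nbhs_singleton nV)) t'T Th.
have -> : F th' t' - F theta t' = F th' t' - F theta t + - (F theta t' - F theta t).
  by rewrite opprB addrA subrK.
by apply: (le_trans (n1D _ _)); rewrite n1N [leRHS]splitr lerD.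
Qed.

End Family.

(** * L1 bounds from the cost *)

Lemma sqnorm_ge0 {k} (v : 'cV[R]_k) : 0 <= sqnorm v.
Proof. by apply: sumr_ge0 => i _; rewrite sqr_ge0. Qed.

(** AM-GM in the form [|a| <= delta + a^2 / delta], summed over the entries. When the squared norm
    is of order [delta^2], both terms are of order [delta]. *)
Lemma n1_le_sqnorm {k} (v : 'cV[R]_k) (delta : R) : 0 < delta ->
  n1 v <= k%:R * delta + sqnorm v / delta.
Proof.
move=> d0; rewrite n1_cV /sqnorm mulr_suml -[k in k%:R]card_ord -sum1_card.
rewrite natr_sum mulr_suml -big_split/=; apply: ler_sum => i _.
rewrite mul1r -(ler_pM2r d0) mulrDl mulfVK ?gt_eqF// -real_normK ?num_real//.
have := normr_ge0 (v i 0); nra.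
Qed.

Lemma measurable_sqnorm {k} (v : R -> 'cV[R]_k) :
  (forall i, measurable_fun `[0, T] (fun t => v t i 0)) ->
  measurable_fun `[0, T] (fun t => sqnorm (v t)).
Proof.
move=> mv; apply: measurable_sum => i.
by apply: measurable_funX; exact: mv.
Qed.

Lemma measurable_cont (f : R -> R) : cont f -> measurable_fun `[0, T] f.
Proof. by move=> cf; exact: subspace_continuous_measurable_fun. Qed.

Lemma measurable_entryB {k} (v w : R -> 'cV[R]_k) :
  (forall i, measurable_fun `[0, T] (fun t => v t i 0)) -> mcont w ->
  forall i, measurable_fun `[0, T] (fun t => (v t - w t) i 0).
Proof.
move=> mv cw i; apply: (eq_measurable_fun (fun t => v t i 0 - w t i 0)).
  by move=> t _; rewrite !mxE.
by apply: measurable_funB; [exact: mv|exact: measurable_cont (cw i 0)].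
Qed.

Lemma intg_ge0_fin (f : R -> R) (c : R) : measurable_fun `[0, T] f ->
  (forall t, 0 <= f t) ->
  (\int[mu]_(t in `[0%R, T]) (f t)%:E <= c%:E)%E ->
  intg f /\ (\int[mu]_(t in `[0, T]) f t)%R <= c.
Proof.
move=> mf f0 fc.
have I : intg f.
  apply/integrableP; split; first exact/measurable_EFinP.
  under eq_integral do rewrite /= ger0_norm//.
  by rewrite (le_lt_trans fc)// ltry.
split=> //; rewrite -lee_fin /Rintegral fineK//; exact: integrable_fin_num.
Qed.

Lemma poweR_half_le (x : \bar R) (delta : R) : (0 <= x)%E ->
  (poweR x 2^-1 <= delta%:E)%E -> (x <= (delta ^+ 2)%:E)%E.
Proof.
case: x => [x|//|//] x0; last first.
  by rewrite poweRyr// leye_eq.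
rewrite lee_fin in x0; rewrite poweR_EFin lee_fin powR12_sqrt// => xd.
have d0 : 0 <= delta by rewrite (le_trans _ xd)// sqrtr_ge0.
by rewrite lee_fin -(sqr_sqrtr x0) lerXn2r// nnegrE sqrtr_ge0.
Qed.

(** [n1_le_sqnorm] is integrated with the same [delta]. For the control, whose squared L2 norm is at
    most [4 * delta^2 / lambda], this gives the factor [T * d + 4 / lambda]; for the output, split
    as [(Y - Ystar) - (Y - C X)], it gives [2 * T * d' + 4 + 1]. The constant [c] dominates both. *)
Lemma cost_L1 {d d'} (C : 'M[R]_(d', d)) (A : R -> 'M[R]_d) (r u X : R -> 'cV[R]_d)
    (Y Ystar : R -> 'cV[R]_d') (x0 : 'cV[R]_d) (lambda delta : R) :
  0 < lambda -> 0 < delta -> mcont A -> mcont r -> mcont Ystar ->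
  (forall i, measurable_fun `[0, T] (fun t => Y t i 0)) ->
  is_L2 T u -> solves_ode T A r u x0 X ->
  (L2dist T Y Ystar <= delta%:E)%E ->
  (\int[mu]_(t in `[0%R, T])
     (sqnorm (Y t - C *m X t) + lambda * sqnorm (u t))%:E
     <= ((2 * delta) ^+ 2)%:E)%E ->
  let c := T * (d%:R + 2 * d'%:R) + 4 / lambda + 5 in
  [/\ mintg u, (\int[mu]_(t in `[0, T]) n1 (u t))%R <= c * delta &
    (\int[mu]_(t in `[0, T]) n1 (C *m X t - Ystar t))%R <= c * delta].
Proof.
move=> l0 d0 cA cr cY mY [mu_ _] S L2 J c.
have TT := T_in T_gt0.
have cX := solves_ode_mcont T_gt0 _ _ _ _ _ S.
have cCX : mcont (fun t => C *m X t) by apply: mcontM => //; exact: mcont_cst.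
have cAXr : mcont (fun t => A t *m X t + r t).
  by apply: mcontD => //; exact: mcontM.
(* Integrability of [u] is read off the equation, by subtracting the continuous [A X + r] from the
   integrable right-hand side. *)
have iu : mintg u.
  have [I _] := (solves_odeP _ _ _ _ _).1 S.
  move=> i j; have := mintgB _ _ I (mcont_mintg _ cAXr) i j.
  by apply: eq_intg => t _; rewrite addrC addKr.
have c0 : 0 <= T * (d%:R + 2 * d'%:R).
  by rewrite mulr_ge0 ?(ltW T_gt0)// addr_ge0// mulr_ge0.
pose q t := sqnorm (Y t - C *m X t) + lambda * sqnorm (u t).
pose P t := sqnorm (Y t - Ystar t).
have q0 t : 0 <= q t by rewrite addr_ge0 ?mulr_ge0 ?sqnorm_ge0 ?ltW.
have P0 t : 0 <= P t by exact: sqnorm_ge0.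
have mq : measurable_fun `[0, T] q.
  apply: measurable_funD; last first.
    by apply: measurable_funM => //; exact: measurable_sqnorm.
  exact: (measurable_sqnorm _ (measurable_entryB _ _ mY cCX)).
have mP : measurable_fun `[0, T] P.
  exact: (measurable_sqnorm _ (measurable_entryB _ _ mY cY)).
have [iq Iq] := intg_ge0_fin _ _ mq q0 J.
have [iP IP] : intg P /\ (\int[mu]_(t in `[0, T]) P t)%R <= delta ^+ 2.
  apply: intg_ge0_fin => //; apply: poweR_half_le => //.
  by apply: integral_ge0 => t _; rewrite lee_fin.
have icst a : intg (fun=> a) by apply/cont_intg/cont_cst.
have Icst a : (\int[mu]_(t in `[0, T]) a)%R = T * a.
  by rewrite Rintegral_cst//= lebesgue_measure_itv/= lte_fin T_gt0/= subr0 mulrC.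
have dn0 : delta != 0 by rewrite gt_eqF.
have ln0 : lambda != 0 by rewrite gt_eqF.
split=> //.
  have i2 : intg (fun t => d%:R * delta + (lambda * delta)^-1 * q t).
    apply: intgD; first exact: icst.
    exact: (intgZ _ _ iq).
  apply: (le_trans (le_int _ _ _ TT (mintg_n1 _ iu) i2 _)) => [t _|].
    apply: (le_trans (n1_le_sqnorm _ _ d0)); rewrite lerD2l.
    rewrite [leLHS](_ : _ = (lambda * delta)^-1 * (lambda * sqnorm (u t))); last first.
      by field; rewrite ?ln0 ?dn0.
    apply: ler_wpM2l; first by rewrite invr_ge0 ltW// mulr_gt0.
    by rewrite /q lerDr sqnorm_ge0.
  rewrite RintegralD//; [|exact: icst|exact: intgZ].
  rewrite Icst RintegralZl//.
  apply: (@le_trans _ _ (T * (d%:R * delta) + (lambda * delta)^-1 * (2 * delta) ^+ 2)).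
    by rewrite lerD2l ler_wpM2l// invr_ge0 ltW// mulr_gt0.
  rewrite (_ : (lambda * delta)^-1 * (2 * delta) ^+ 2 = 4 / lambda * delta); last first.
    by field; rewrite ?ln0 ?dn0.
  rewrite mulrA -mulrDl ler_wpM2r ?(ltW d0)// /c.
  have : 0 <= T * d'%:R by rewrite mulr_ge0// ltW.
  lra.
have i2 : intg (fun t => 2 * d'%:R * delta + delta^-1 * (q t + P t)).
  by apply: intgD => //; apply: intgZ; exact: intgD.
have i3 : mintg (fun t => C *m X t - Ystar t) by apply: mcont_mintg; exact: mcontB.
apply: (le_trans (le_int _ _ _ TT (mintg_n1 _ i3) i2 _)) => [t _|].
  have -> : C *m X t - Ystar t = (Y t - Ystar t) + - (Y t - C *m X t).
    by rewrite opprB [RHS]addrC addrA subrK.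
  apply: (le_trans (n1D _ _)); rewrite n1N.
  have h1 := n1_le_sqnorm (Y t - Ystar t) _ d0.
  have h2 := n1_le_sqnorm (Y t - C *m X t) _ d0.
  apply: (le_trans (lerD h1 h2)); rewrite -/(P t).
  rewrite (_ : 2 * d'%:R * delta + delta^-1 * (q t + P t) =
    d'%:R * delta + P t / delta + (d'%:R * delta + q t / delta)); last by ring.
  rewrite !lerD2l.
  apply: ler_wpM2r; first by rewrite invr_ge0 ltW.
  by rewrite /q lerDl mulr_ge0 ?sqnorm_ge0// ltW.
rewrite RintegralD//; [|exact: icst|by apply: intgZ; exact: intgD].
rewrite Icst RintegralZl//; last exact: intgD.
rewrite RintegralD//.
apply: (@le_trans _ _ (T * (2 * d'%:R * delta) +
    delta^-1 * ((2 * delta) ^+ 2 + delta ^+ 2))).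
  by rewrite lerD2l ler_wpM2l ?invr_ge0 ?(ltW d0)// lerD.
rewrite (_ : delta^-1 * _ = 5 * delta); last by field.
rewrite mulrA -mulrDl ler_wpM2r ?(ltW d0)// /c.
have : 0 <= T * d%:R by rewrite mulr_ge0// ltW.
have : 0 <= 4 / lambda by rewrite divr_ge0// ltW.
lra.
Qed.

End CostControl.

(** * Local exclusion and compactness *)

Section Identification.
Context {R : realType} {T : R} (T_gt0 : 0 < T).
Local Notation mu := (@lebesgue_measure R).
Local Notation mcont := (@mcont R T _ _).
Local Notation mintg := (@mintg R T _ _).

Context {d d' p : nat} (C : 'M[R]_(d', d)) (Theta : set 'cV[R]_p).
Context (A : 'cV[R]_p -> R -> 'M[R]_d) (r : 'cV[R]_p -> R -> 'cV[R]_d).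
Context (Y : R -> 'cV[R]_d').
Hypothesis cA : {within [set tz : R * 'cV[R]_p | tz.1 \in `[0%R, T] /\ Theta tz.2],
  continuous (fun tz : R * 'cV[R]_p => A tz.2 tz.1)}.
Hypothesis cr : {within [set tz : R * 'cV[R]_p | tz.1 \in `[0%R, T] /\ Theta tz.2],
  continuous (fun tz : R * 'cV[R]_p => r tz.2 tz.1)}.
Hypothesis cY : mcont Y.
Hypothesis observable : forall theta, Theta theta ->
  forall Phi, is_resolvent T (A theta) Phi -> gramian T C Phi \in unitmx.

(** [Y] stands for the true output here: [cost_L1] eliminates the data and [lambda], and what
    remains depends on a single small number. *)
Definition fits (delta : R) (theta : 'cV[R]_p) : Prop :=
  exists x0 u X, [/\ solves_ode T (A theta) (r theta) u x0 X, mintg u,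
    (\int[mu]_(t in `[0, T]) n1 (u t))%R <= delta &
    (\int[mu]_(t in `[0, T]) n1 (C *m X t - Y t))%R <= delta].

(** Suppose [theta'] fits, and let [N = 1 + n1 x0]. Coercivity bounds [N] by [c] times the L1 norm
    of [C Z - Y], while the perturbation bound makes that quantity at most a small multiple of [N]
    plus a multiple of [delta]; this contradicts [N >= 1]. Both estimates are linear in [N], so the
    neighbourhood does not depend on [x0]. *)
Lemma not_fits_near theta : Theta theta ->
  (forall x0 X, solves_ode T (A theta) (r theta) (fun=> 0) x0 X ->
     ~ forall t, t \in `[0, T] -> C *m X t = Y t) ->
  \forall theta' \near theta & delta \near 0^'+,
    Theta theta' -> ~ fits delta theta'.
Proof.
move=> Th noX; have TT := T_in T_gt0.
have cAt := family_mcont Theta A cA _ Th.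
have crt := family_mcont Theta r cr _ Th.
have [Z [c [c0 HZ]]] := output_gap T_gt0 C _ _ _ cAt crt cY (observable _ Th) noX.
have [K0 K0_ge0 AK] := mcont_bounded T_gt0 _ cAt.
(* The extra 1 makes [K] positive and, as [eta <= 1], lets it bound [A theta'] as well as
   [A theta]. *)
pose K := K0 + 1; have K_gt0 : 0 < K by rewrite /K ltr_wpDl.
(* [L] collects the Gronwall factor with [T] and the norm of [C]. In the final inequality [b] is the
   coefficient of [eta * N] and [e] that of [delta]; [eta] and [dl] are chosen so that [b * eta] and
   [e * dl] are at most 1/4. *)
pose L := n1 C * T * (2 * expR (2 * K * T)).
have L0 : 0 <= L.
  by rewrite /L !mulr_ge0 ?n1_ge0 ?expR_ge0// ltW.
have T0 := ltW T_gt0.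
pose b := c * L * T * (c + 1).
have b0 : 0 <= b by rewrite /b; do !apply: mulr_ge0 => //; exact: addr_ge0.
pose eta := Num.min 1 (4 * (1 + b))^-1.
have eta0 : 0 < eta by rewrite lt_min ltr01 invr_gt0 mulr_gt0// ltr_wpDr.
have eta1 : eta <= 1 by rewrite ge_min lexx.
have etab : b * eta <= 1 / 4.
  apply: (@le_trans _ _ (b * (4 * (1 + b))^-1)).
    by rewrite ler_wpM2l// ge_min lexx orbT.
  rewrite ler_pdivrMr ?mulr_gt0 ?ltr_wpDr//; lra.
pose e := c * (1 + L).
have e0 : 0 <= e by rewrite /e mulr_ge0// addr_ge0.
pose dl := (4 * (1 + e))^-1.
have dl0 : 0 < dl by rewrite invr_gt0 mulr_gt0// ltr_wpDr.
have near_th : \forall theta' \near theta, Theta theta' ->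
    forall t, t \in `[0, T] ->
    n1 (A theta' t - A theta t) <= eta /\ n1 (r theta' t - r theta t) <= eta.
  have := family_close Theta A cA _ _ Th eta0.
  have := family_close Theta r cr _ _ Th eta0.
  apply: filterS2 => th' h1 h2 Th' t tT; split; [exact: h2|exact: h1].
have near_d : \forall delta \near (0 : R)^'+, 0 < delta <= dl.
  near=> delta; apply/andP; split; near: delta.
    exact: nbhs_right_gt.
  exact: nbhs_right_le.
pose U := [set theta' | Theta theta' -> forall t, t \in `[0, T] ->
    n1 (A theta' t - A theta t) <= eta /\ n1 (r theta' t - r theta t) <= eta].
exists (U, [set delta | 0 < delta <= dl]) => //.
move=> [theta' delta] /= [Uth /andP[d0 ddl]] Th' [x0 [u [X [SX iu Iu IX]]]].
have cAt' := family_mcont Theta A cA _ Th'.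
have crt' := family_mcont Theta r cr _ Th'.
have [SZ Zc gap] := HZ x0.
have nx0 := n1_ge0 x0.
have AK' t : t \in `[0, T] -> n1 (A theta' t) <= K.
  move=> tT; rewrite -(subrK (A theta t) (A theta' t)).
  apply: (le_trans (n1D _ _)); rewrite addrC /K lerD ?AK//.
  by apply: le_trans eta1; have [] := Uth Th' t tT.
pose N := 1 + n1 x0.
have N1 : 1 <= N by rewrite /N lerDl.
have c0' : 0 <= c * N by rewrite mulr_ge0// (le_trans ler01).
pose D := 2 * (T * (eta * (c * N + 1)) + delta) * expR (2 * K * T).
have XZ t : t \in `[0, T] -> n1 (X t - Z x0 t) <= D.
  exact: (ode_perturb T_gt0 _ _ _ _ _ _ _ _ _ _ _ _ K_gt0 (ltW eta0) c0' (ltW d0)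
  cAt cAt' crt crt' SX SZ iu AK' (fun t tT => (Uth Th' t tT).1)
  (fun t tT => (Uth Th' t tT).2) Zc Iu t).
have D0 : 0 <= D.
  by rewrite /D !mulr_ge0 ?expR_ge0 ?addr_ge0 ?mulr_ge0 ?addr_ge0 ?(ltW d0) ?(ltW eta0).
have cX := solves_ode_mcont T_gt0 _ _ _ _ _ SX.
have cZ := solves_ode_mcont T_gt0 _ _ _ _ _ SZ.
have iCX : @intg R T (fun t => n1 (C *m X t - Y t)).
  apply: cont_intg; apply: mcont_n1; apply: mcontB => //.
  by apply: mcontM => //; exact: mcont_cst.
have iCZ : @intg R T (fun t => n1 (C *m Z x0 t - Y t)).
  apply: cont_intg; apply: mcont_n1; apply: mcontB => //.
  by apply: mcontM => //; exact: mcont_cst.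
have icst : @intg R T (fun=> n1 C * D) by apply/cont_intg/cont_cst.
have IZ : (\int[mu]_(t in `[0, T]) n1 (C *m Z x0 t - Y t))%R <=
    delta + T * (n1 C * D).
  apply: (@le_trans _ _ (\int[mu]_(t in `[0, T])
      (n1 (C *m X t - Y t) + n1 C * D))%R).
    apply: (le_int _ _ _ TT iCZ (intgD _ _ iCX icst)) => t tT.
    have -> : C *m Z x0 t - Y t = (C *m X t - Y t) + - (C *m (X t - Z x0 t)).
      by rewrite mulmxBr opprB [RHS]addrC addrA subrK.
    apply: (le_trans (n1D _ _)); rewrite lerD2l n1N.
    by apply: (le_trans (n1_mul _ _)); rewrite ler_wpM2l ?n1_ge0 ?XZ.
  rewrite RintegralD//; apply: lerD => //; apply: le_int_cst => //.
  by rewrite mulr_ge0 ?n1_ge0.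
have {}gap : N <= c * (delta + T * (n1 C * D)).
  by apply: (le_trans gap); rewrite ler_wpM2l.
have DE : T * (n1 C * D) = L * (T * (eta * (c * N + 1)) + delta).
  by rewrite /D /L; ring.
(* [gap] now reads [N <= e * delta + b * eta * N], with both coefficients at
   most 1/4. *)
have h1 : e * delta <= 1 / 4.
  apply: (@le_trans _ _ (e * dl)); first by rewrite ler_wpM2l.
  rewrite /dl ler_pdivrMr ?mulr_gt0 ?ltr_wpDr//; lra.
have h2 : c * N + 1 <= (c + 1) * N by rewrite mulrDl mul1r lerD2l.
have h3 : c * (L * (T * (eta * (c * N + 1)))) <= b * eta * N.
  rewrite /b (_ : c * L * T * (c + 1) * eta * N =
    c * (L * (T * (eta * ((c + 1) * N))))); last by ring.
  by rewrite !ler_wpM2l// ltW.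
have h4 : b * eta * N <= 1 / 4 * N by rewrite ler_wpM2r// (le_trans ler01).
have h5 : c * (delta + T * (n1 C * D)) =
   e * delta + c * (L * (T * (eta * (c * N + 1)))).
  by rewrite DE /e; ring.
rewrite h5 in gap; lra.
Unshelve. all: by end_near.
Qed.

(** Away from [theta_star], identifiability makes [not_fits_near] applicable; at [theta_star] the
    ball of radius [eps] is itself a suitable neighbourhood. Compactness merges the local ranges of
    [delta] into one. *)
Lemma fits_near_star theta_star (eps : R) : compact Theta -> 0 < eps ->
  (forall theta x0 X, Theta theta ->
     solves_ode T (A theta) (r theta) (fun=> 0) x0 X ->
     (forall t, t \in `[0, T] -> C *m X t = Y t) -> theta = theta_star) ->
  \forall delta \near 0^'+,
    forall theta, Theta theta -> fits delta theta -> `|theta - theta_star| < eps.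
Proof.
move=> /compact_near_coveringP cT eps0 ident.
pose P (delta : R) theta := Theta theta -> fits delta theta ->
  `|theta - theta_star| < eps.
suff H : \forall delta \near (0 : R)^'+, Theta `<=` P delta.
  by apply: filterS H => delta h th Th; exact: h.
apply: cT => theta Th.
have [->|neq] := eqVneq theta theta_star.
  exists ([set th | `|th - theta_star| < eps], setT) => /=.
    split; last exact: filterT.
    have := @cvgr_dist_lt _ _ _ (nbhs theta_star) _ id theta_star (@cvg_id _ _).
    move=> /(_ (nbhs_filter _) eps eps0).
    by apply: filterS => th; rewrite distrC.
  by move=> [th delta] /= [h _] _ _.
have [|[U V] [nU nV] UV] := not_fits_near _ Th.
  by move=> x0 X S E; move/eqP: neq; apply; exact: ident S E.
by exists (U, V) => // -[th delta] /UV /= h Th' ft; case: (h Th').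
Qed.

End Identification.

(** * The minimiser and convergence in probability *)

Lemma sqnorm0 {R : realType} k : sqnorm (0 : 'cV[R]_k) = 0.
Proof. by apply: big1 => i _; rewrite mxE expr0n. Qed.

(** Zero control and the true initial condition bound the cost of [theta_star] by [delta^2]. The
    strictly larger level [(2 * delta)^2] guarantees an actual trajectory of [theta] below it,
    without a minimising control. *)
Lemma argmin_fits {R : realType} {T : R} (T_gt0 : 0 < T) {d d' p : nat}
  (C : 'M[R]_(d', d)) (A : 'cV[R]_p -> R -> 'M[R]_d) (r : 'cV[R]_p -> R -> 'cV[R]_d)
  (theta theta_star : 'cV[R]_p) (x0_star : 'cV[R]_d) (Xstar : R -> 'cV[R]_d)
  (Y : R -> 'cV[R]_d') (lambda delta : R) :
  @mcont R T _ _ (A theta) -> @mcont R T _ _ (r theta) ->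
  solves_ode T (A theta_star) (r theta_star) (fun=> 0) x0_star Xstar ->
  0 < lambda -> 0 < delta -> is_Linfty T Y ->
  (L2dist T Y (fun t => C *m Xstar t) <= delta%:E)%E ->
  (Scost T C (A theta) (r theta) lambda Y <=
     Scost T C (A theta_star) (r theta_star) lambda Y)%E ->
  @fits R T d d' p C A r (fun t => C *m Xstar t)
    ((T * (d%:R + 2 * d'%:R) + 4 / lambda + 5) * delta) theta.
Proof.
move=> cA cr Sstar l0 d0 [mY _] L2 le_cost.
have cXs := solves_ode_mcont T_gt0 _ _ _ _ _ Sstar.
have cCX : @mcont R T _ _ (fun t => C *m Xstar t).
  by apply: mcontM => //; exact: mcont_cst.
have : (Scost T C (A theta) (r theta) lambda Y < ((2 * delta) ^+ 2)%:E)%E.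
  apply: (le_lt_trans le_cost).
  apply: (@le_lt_trans _ _ (delta ^+ 2)%:E); last first.
    by rewrite lte_fin exprMn ltr_pMl ?exprn_gt0//; lra.
  apply: (@le_trans _ _ (\int[@lebesgue_measure R]_(t in `[0%R, T])
     (sqnorm (Y t - C *m Xstar t) + lambda * sqnorm (0 : 'cV[R]_d))%:E)%E).
    apply: ereal_inf_lbound; exists x0_star, (fun=> 0), Xstar; split=> //.
    split; first by move=> i; exact: measurable_cst.
    under eq_integral do rewrite sqnorm0.
    by rewrite integral0.
  under eq_integral do rewrite sqnorm0 mulr0 addr0.
  apply: poweR_half_le => //.
  by apply: integral_ge0 => t _; rewrite lee_fin sqnorm_ge0.
move=> /ereal_inf_lt[_ [x0 [u [X [uL2 [S ->]]]]] /ltW J].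
by have [iu Iu IX] := cost_L1 T_gt0 C _ _ _ _ _ _ _ _ _ l0 d0 cA cr cCX mY uL2 S L2 J;
  exists x0, u, X.
Qed.

Theorem mainTheorem6
  (R : realType) (T : R) (d d' p : nat)
  (C : 'M[R]_(d', d)) (Theta : set 'cV[R]_p)
  (A : 'cV[R]_p -> R -> 'M[R]_d) (r : 'cV[R]_p -> R -> 'cV[R]_d)
  (theta_star : 'cV[R]_p) (x0_star : 'cV[R]_d) (Xstar : R -> 'cV[R]_d)
  (lambda : R)
  (dO : measure_display) (Omega : measurableType dO) (P : probability Omega R)
  (Yhat : nat -> Omega -> R -> 'cV[R]_d') (thetahat : nat -> Omega -> 'cV[R]_p) :
  0 < T ->
  (* X* = X_{theta*, x0*} *)
  solves_ode T (A theta_star) (r theta_star) (fun=> 0) x0_star Xstar ->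
  (* C1 *)
  compact Theta -> interior Theta theta_star ->
  (* C2a *)
  (forall theta, Theta theta -> forall Phi, is_resolvent T (A theta) Phi ->
     gramian T C Phi \in unitmx) ->
  (* C2b *)
  (forall theta x0 X, Theta theta -> solves_ode T (A theta) (r theta) (fun=> 0) x0 X ->
     (forall t, t \in `[0%R, T] -> C *m X t = C *m Xstar t) ->
     theta = theta_star /\ x0 = x0_star) ->
  (* C3 *)
  {within [set tz : R * 'cV[R]_p | tz.1 \in `[0%R, T] /\ Theta tz.2],
     continuous (fun tz : R * 'cV[R]_p => A tz.2 tz.1)} ->
  {within [set tz : R * 'cV[R]_p | tz.1 \in `[0%R, T] /\ Theta tz.2],
     continuous (fun tz : R * 'cV[R]_p => r tz.2 tz.1)} ->
  0 < lambda ->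
  (* Yhat_n in L^oo([0,T], R^d') *)
  (forall n w, is_Linfty T (Yhat n w)) ->
  (* Yhat_n -> Y* = C X* in L^2, in probability *)
  (forall n, measurable_fun [set: Omega] ((fun w => L2dist T (Yhat n w) (fun t => C *m Xstar t)) : Omega -> \bar R)) ->
  (forall eps : R, 0 < eps ->
     P [set w | (eps%:E < L2dist T (Yhat n w) (fun t => C *m Xstar t))%E]
       @[n --> \oo] --> 0%E) ->
  (* thetahat_n = argmin_{theta in Theta} S(Yhat_n; theta, lambda) *)
  (forall n w, Theta (thetahat n w) /\
     forall theta, Theta theta ->
       (Scost T C (A (thetahat n w)) (r (thetahat n w)) lambda (Yhat n w)
        <= Scost T C (A theta) (r theta) lambda (Yhat n w))%E) ->
  (forall n, measurable_fun [set: Omega] ((fun w => `|thetahat n w - theta_star|) : Omega -> R)) ->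
  (* conclusion: thetahat_n -> theta* in probability *)
  forall eps : R, 0 < eps ->
    P [set w | eps < `|thetahat n w - theta_star|] @[n --> \oo] --> 0%E.
Proof.
move=> T0 Sstar cTheta intTheta obs ident cA cr l0 YL mL cL argmin mth eps eps0.
have cXs := solves_ode_mcont T0 _ _ _ _ _ Sstar.
have cCX : @mcont R T _ _ (fun t => C *m Xstar t).
  by apply: mcontM => //; exact: mcont_cst.
have Thstar : Theta theta_star by exact: interior_subset.
have c_gt0 : 0 < T * (d%:R + 2 * d'%:R) + 4 / lambda + 5.
  have : 0 <= T * (d%:R + 2 * d'%:R).
    by rewrite mulr_ge0 ?(ltW T0)// addr_ge0// mulr_ge0.
  have : 0 <= 4 / lambda by rewrite divr_ge0// ltW.
  lra.
have [delta [/= d0 near_star]] : exists delta, 0 < delta /\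
    forall theta, Theta theta ->
    @fits R T d d' p C A r (fun t => C *m Xstar t)
      ((T * (d%:R + 2 * d'%:R) + 4 / lambda + 5) * delta) theta ->
    `|theta - theta_star| < eps.
  have near_star : \forall delta \near (0 : R)^'+, forall theta, Theta theta ->
      @fits R T d d' p C A r (fun t => C *m Xstar t) delta theta ->
      `|theta - theta_star| < eps.
    apply: (fits_near_star T0 _ Theta) => // theta x0 X Th S E.
    by have [] := ident theta x0 X Th S E.
  have [delta [fit d0]] : exists delta : R, (forall theta, Theta theta ->
      @fits R T d d' p C A r (fun t => C *m Xstar t) delta theta ->
      `|theta - theta_star| < eps) /\ 0 < delta.
    by apply: (@filter_ex _ (0 : R)^'+); apply: filterI near_star (nbhs_right_gt (0 : R)).
  (* The threshold is divided by the constant of [argmin_fits], so that the fit provided by that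
     lemma meets it exactly. *)
  exists (delta / (T * (d%:R + 2 * d'%:R) + 4 / lambda + 5)); split.
    by rewrite divr_gt0.
  by rewrite mulrC divfK ?gt_eqF.
(* The deterministic claim, applied at each outcome [w], is an inclusion of events; monotonicity of
   [P] then squeezes the probabilities. *)
have sub n : [set w | eps < `|thetahat n w - theta_star|] `<=`
    [set w | (delta%:E < L2dist T (Yhat n w) (fun t => C *m Xstar t))%E].
  move=> w /=; rewrite !ltNge; apply: contraNN => L2; rewrite ltW//.
  have [Th le_cost] := argmin n w.
  apply: near_star => //.
  apply: (argmin_fits T0) (le_cost _ Thstar) => //.
  - exact: family_mcont cA _ Th.
  - exact: family_mcont cr _ Th.
apply: (@squeeze_cvge _ _ _ _ (cst 0%E) _
  (fun n => P [set w | (delta%:E < L2dist T (Yhat n w) (fun t => C *m Xstar t))%E])).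
- apply: nearW => n; rewrite measure_ge0/=; apply: le_measure; rewrite ?inE.
  + have := mth n measurableT _ (measurable_itv `]eps, +oo[); rewrite setTI.
    by congr measurable; apply/seteqP; split=> w /=; rewrite in_itv/= andbT.
  + have := mL n measurableT _ (emeasurable_itv `]delta%:E, +oo[); rewrite setTI.
    by congr measurable; apply/seteqP; split=> w /=; rewrite in_itv/= andbT.
  + exact: sub.
- exact: cvg_cst.
- exact: cL.
Qed.
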